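(* Let $d\ge 1$, $\lambda>0$, $\delta>0$, and let $f:\mathbb{R}^d\to\mathbb{R}$ satisfy: (A1) $f$ is continuous and has at least one minimizer; (A2) $\int_{\mathbb{R}^d}\exp(-f(y)/\delta)\,dy<+\infty$. Then the zeroth-order proximal operator $\operatorname{zprox}^\delta_{\lambda,f}$ is $C^\infty$ and bijective, and \[ \operatorname{zprox}^\delta_{\lambda,f}=\operatorname{prox}_{\lambda\delta H_{\lambda,\delta}}, \] where $H_{\lambda,\delta}:\mathbb{R}^d\to\mathbb{R}$ is defined by \[ H_{\lambda,\delta}(x)=-\frac{1}{2\lambda\delta}\big\|(\operatorname{zprox}^\delta_{\lambda,f})^{-1}(x)-x\big\|^2+\frac{1}{\delta}f^{\lambda,\delta}\big((\operatorname{zprox}^\delta_{\lambda,f})^{-1}(x)\big). \] In particular, the sequence $(x^k)_{k\in\mathbb{N}}$ generated by ZOPPA is a proximal point iteration, i.e. $x^{k+1}=\operatorname{prox}_{\lambda\delta H_{\lambda,\delta}}(x^k)$ for all $k$.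
   Context: The zeroth-order proximal operator is $\operatorname{zprox}^\delta_{\lambda,f}(x)=\dfrac{\mathbb{E}_{y\sim\mathcal N(x,\lambda\delta I)}[y\exp(-f(y)/\delta)]}{\mathbb{E}_{y\sim\mathcal N(x,\lambda\delta I)}[\exp(-f(y)/\delta)]}$, and the soft Moreau envelope is $f^{\lambda,\delta}(x)=-\delta\log\mathbb{E}_{y\sim\mathcal N(x,\lambda\delta I)}[\exp(-f(y)/\delta)]$. For a function $g:\mathbb{R}^d\to\mathbb{R}$ and $t>0$, $\operatorname{prox}_{tg}(x)=\operatorname{argmin}_{y\in\mathbb{R}^d}\{t\,g(y)+\tfrac12\|y-x\|^2\}$. ZOPPA (Zeroth-Order Proximal Point Algorithm): given $x^0\in\mathbb{R}^d$, iterate $x^{k+1}=\operatorname{zprox}^\delta_{\lambda,f}(x^k)$ for $k\ge 0$. *)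

(* Defs.v *)
From HB Require Import structures.
From mathcomp Require Import all_boot all_order all_algebra.
From mathcomp Require Import all_classical all_reals all_analysis.

Set Implicit Arguments.
Unset Strict Implicit.
Unset Printing Implicit Defensive.

Import Order.TTheory GRing.Theory Num.Theory.
Import numFieldNormedType.Exports.
Local Open Scope classical_set_scope.
Local Open Scope ring_scope.

(* Squared Euclidean norm on R^d (mathcomp's `|.| on 'rV is the max norm). *)
Definition sqnorm (R : realType) (n : nat) (v : 'rV[R]_n) : R :=
  \sum_(i < n) (v ord0 i) ^+ 2.

Definition cons_rV (R : realType) (n : nat) (t : R) (v : 'rV[R]_n) : 'rV[R]_n.+1 :=
  \row_(i < n.+1) match unlift ord0 i with Some j => v ord0 j | None => t end.

(* Lebesgue integral over R^n, realised as the iterated one-dimensional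
   Lebesgue integral (Fubini/Tonelli); extended-real valued. *)
Fixpoint intRn (R : realType) (n : nat) {struct n} : ('rV[R]_n -> \bar R) -> \bar R :=
  match n return ('rV[R]_n -> \bar R) -> \bar R with
  | 0 => fun g => g 0
  | n'.+1 => fun g =>
      (\int[@lebesgue_measure R]_t intRn (fun v => g (cons_rV t v)))%E
  end.

Definition RintRn (R : realType) (n : nat) (g : 'rV[R]_n -> R) : R :=
  fine (intRn (fun y => (g y)%:E)).

Definition gauss_dens (R : realType) (n : nat) (s : R) (x y : 'rV[R]_n) : R :=
  powR (2 * pi * s) (- (n%:R) / 2) * expR (- sqnorm (y - x) / (2 * s)).

Definition gauss_exp (R : realType) (n : nat) (s : R) (x : 'rV[R]_n)
  (g : 'rV[R]_n -> R) : R :=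
  RintRn (fun y => gauss_dens s x y * g y).

Definition zprox (R : realType) (n : nat) (lam del : R) (f : 'rV[R]_n -> R)
  (x : 'rV[R]_n) : 'rV[R]_n :=
  (gauss_exp (lam * del) x (fun y => expR (- f y / del)))^-1 *:
  \row_(i < n) gauss_exp (lam * del) x (fun y => y ord0 i * expR (- f y / del)).

Definition soft_moreau (R : realType) (n : nat) (lam del : R) (f : 'rV[R]_n -> R)
  (x : 'rV[R]_n) : R :=
  - del * ln (gauss_exp (lam * del) x (fun y => expR (- f y / del))).

Definition Hfun (R : realType) (n : nat) (lam del : R) (f : 'rV[R]_n -> R)
  (zinv : 'rV[R]_n -> 'rV[R]_n) (x : 'rV[R]_n) : R :=
  - (sqnorm (zinv x - x)) / (2 * lam * del) + (soft_moreau lam del f (zinv x)) / del.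

(* argmin set of  y |-> g y + 1/2 ||y - x||^2 ; prox_g(x) = p means this set is {p} *)
Definition prox_set (R : realType) (n : nat) (g : 'rV[R]_n -> R) (x : 'rV[R]_n)
  : set 'rV[R]_n :=
  [set p | forall y, g p + sqnorm (p - x) / 2 <= g y + sqnorm (y - x) / 2].

Definition iter_partial (R : realType) (n : nat) (s : seq 'I_n)
  (F : 'rV[R]_n -> 'rV[R]_n) : 'rV[R]_n -> 'rV[R]_n :=
  foldr (fun i G => fun x => derive G x (delta_mx ord0 i)) F s.

Definition smooth (R : realType) (n : nat) (F : 'rV[R]_n -> 'rV[R]_n) : Prop :=
  forall s : seq 'I_n,
    continuous (iter_partial s F) /\
    forall (i : 'I_n) (x : 'rV[R]_n), derivable (iter_partial s F) x (delta_mx ord0 i).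

(* Main.v *)
Require Import Defs.
From HB Require Import structures.
From mathcomp Require Import all_boot all_order all_algebra.
From mathcomp Require Import all_classical all_reals all_analysis.
From mathcomp Require Import measurable_realfun ring lra.
Import Order.TTheory GRing.Theory Num.Theory.
Import numFieldNormedType.Exports.
Local Open Scope classical_set_scope.
Local Open Scope ring_scope.

Set Implicit Arguments.
Unset Strict Implicit.
Unset Printing Implicit Defensive.

(* With s = lam * del and w = exp (- f / del), expanding |y - x|^2 shows that
   zprox x is the mean of the probability proportional to
     exp (<x, y> / s) exp (- |y|^2 / 2s) w y dy,
   i.e. zprox = grad phi for phi = s ln L, where
   L x = int exp (<x, y> / s) exp (- |y|^2 / 2s) w y dy.  As f has a minimizer, w is
   bounded, so every integrand below is a Gaussian times a function of at most
   exponential growth; differentiation under the integral sign then only needs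
   linearity and monotonicity of the integral, and zprox is a quotient of smooth
   functions.
   The strict inequality 1 + u < exp u (u <> 0), integrated against the tilted
   measure at x', gives strict convexity of phi in the form
     phi x > phi x' + <x - x', zprox x'>   for x <> x',
   hence injectivity.  Surjectivity: for any z, exp (- <x, z> / s) L x is coercive,
   and its minimizer x satisfies zprox x = z.  Finally, up to a term depending only on x,
   the prox objective at y = zprox x' is - phi x' - <x - x', zprox x'>, so strict
   convexity says precisely that its only minimizer is x' = x. *)

(** * Iterated integrals of dominated continuous functions *)

Section slices.
Context {R : realType}.

Lemma continuous_row (T : topologicalType) n (F : T -> 'rV[R]_n) :
  (forall i, continuous (fun x => F x ord0 i)) -> continuous F.
Proof.
move=> cF x; apply/cvgrPdist_lt => e e0.
have H : \forall t \near nbhs x, forall i, `|F x ord0 i - F t ord0 i| < e.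
  apply: filter_forall => i.
  by have /cvgrPdist_lt/(_ e e0) := cF i x.
apply: filterS H => t Ht.
rewrite [X in X < _]/Num.norm/= mx_normrE; apply/bigmax_ltP; split=> // -[i j] _ /=.
by rewrite !mxE (ord1 i).
Qed.

Lemma cons_rV0 n t (v : 'rV[R]_n) : cons_rV t v ord0 ord0 = t.
Proof. by rewrite mxE unlift_none. Qed.

Lemma cons_rVS n t (v : 'rV[R]_n) j : cons_rV t v ord0 (lift ord0 j) = v ord0 j.
Proof. by rewrite mxE liftK. Qed.

Lemma cons_rVK n (v : 'rV[R]_n.+1) :
  cons_rV (v ord0 ord0) (\row_j v ord0 (lift ord0 j)) = v.
Proof.
apply/rowP => i; case: (unliftP ord0 i) => [j|] ->.
  by rewrite cons_rVS mxE.
by rewrite cons_rV0.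
Qed.

Lemma continuous_cons_rVr n t : continuous (@cons_rV R n t).
Proof.
apply: continuous_row => i; case: (unliftP ord0 i) => [j|] ->.
  rewrite (_ : (fun _ => _) = fun v : 'rV_n => v ord0 j).
    exact: coord_continuous.
  by apply/funext => v; rewrite cons_rVS.
rewrite (_ : (fun _ => _) = fun=> t); first exact: cst_continuous.
by apply/funext => v; rewrite cons_rV0.
Qed.

Lemma continuous_cons_rVl n (v : 'rV[R]_n) : continuous (fun t => cons_rV t v).
Proof.
apply: continuous_row => i; case: (unliftP ord0 i) => [j|] ->.
  rewrite (_ : (fun _ => _) = fun=> v ord0 j); first exact: cst_continuous.
  by apply/funext => t; rewrite cons_rVS.
rewrite (_ : (fun _ => _) = id); first by move=> x.
by apply/funext => t; rewrite cons_rV0.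
Qed.

End slices.

(** * Induction on the dimension for iterated integrals *)

Section iterated_integral.
Context {R : realType} (k : R -> R).
Local Notation mu := (@lebesgue_measure R).
Hypothesis k_ge0 : forall t, 0 <= k t.
Hypothesis k_le1 : forall t, k t <= 1.
Hypothesis k_int : mu.-integrable setT (EFin \o k).

Let K := (\int[mu]_t k t)%R.

Definition prodk n (v : 'rV[R]_n) := \prod_(i < n) k (v ord0 i).

Let prodk_ge0 n (v : 'rV[R]_n) : 0 <= prodk v.
Proof. by apply: prodr_ge0. Qed.

Let prodk_cons n t (v : 'rV[R]_n) : prodk (cons_rV t v) = k t * prodk v.
Proof.
rewrite /prodk big_ord_recl cons_rV0; congr (_ * _).
by apply: eq_bigr => i _; rewrite cons_rVS.
Qed.

(** Domination by a product kernel passes to slices: fixing the first coordinate at [t] turns the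
    constant [C] into [C * k t]. This is what lets the proofs go by induction on [n]. *)
Definition dominated n (C : R) (g : 'rV[R]_n -> R) :=
  [/\ continuous g, 0 <= C & forall y, `|g y| <= C * prodk y].

Let dominated_slice n C (g : 'rV[R]_n.+1 -> R) t :
  dominated C g -> dominated (C * k t) (fun v => g (cons_rV t v)).
Proof.
case=> cg C0 gC; split; last 2 first.
- exact: mulr_ge0.
- by move=> y; rewrite -mulrA -prodk_cons.
- move=> v; apply: (@continuous_comp _ _ _ (cons_rV t) g).
    exact: continuous_cons_rVr.
  exact: cg.
Qed.

Let dominatedW n C D (g : 'rV[R]_n -> R) :
  dominated C g -> C <= D -> dominated D g.
Proof.
case=> cg C0 gC CD; split => //; first exact: le_trans CD.
by move=> y; apply: le_trans (gC y) _; rewrite ler_wpM2r.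
Qed.

(** The explicit constant matters: on the slice at [t] it reads [C * k t * K ^+ n], an integrable
    function of [t] that serves as the dominating function one dimension up. *)
Let fin_bound n := forall C (g : 'rV[R]_n -> R), dominated C g ->
  intRn (fun y => (g y)%:E) = (RintRn g)%:E /\ `|RintRn g| <= C * K ^+ n.

Let seq_cvg n := forall C (g_ : nat -> 'rV[R]_n -> R) (g : 'rV[R]_n -> R),
  (forall m, dominated C (g_ m)) -> dominated C g ->
  (forall y, g_ m y @[m --> \oo] --> g y) ->
  RintRn (g_ m) @[m --> \oo] --> RintRn g.

(** Along a sequence tending to [t] the slices converge pointwise, and [k <= 1] makes [C] a common
    constant for all of them, so dominated convergence in dimension [n] applies. *)
Let slice_continuous n : seq_cvg n -> forall C (g : 'rV[R]_n.+1 -> R),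
  dominated C g -> continuous (fun t => RintRn (fun v => g (cons_rV t v))).
Proof.
move=> dct C g dg t; apply/(@cvg_nbhsP _ R^o) => u ut.
apply: (dct C).
- move=> m; apply: dominatedW (dominated_slice (u m) dg) _.
  by case: dg => _ C0 _; rewrite ler_piMr.
- apply: dominatedW (dominated_slice t dg) _.
  by case: dg => _ C0 _; rewrite ler_piMr.
- move=> v; apply: continuous_cvg; first by case: dg => cg _ _; exact: cg.
  exact: cvg_comp ut (@continuous_cons_rVl _ _ v t).
Qed.

Let integrableZk C : mu.-integrable setT (fun t => (C * k t)%:E).
Proof.
under eq_fun do rewrite EFinM.
exact: integrableZl.
Qed.

Let slice_integrable n : fin_bound n -> seq_cvg n -> forall C (g : 'rV[R]_n.+1 -> R),
  dominated C g ->
  mu.-integrable setT (fun t => (RintRn (fun v => g (cons_rV t v)))%:E).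
Proof.
move=> fin dct C g dg; have cG := slice_continuous dct dg.
apply: (le_integrable _ _ _ (integrableZk (C * K ^+ n))) => //.
  by apply/measurable_EFinP; exact: continuous_measurable_fun.
move=> t _; rewrite /= lee_fin.
have [_] := fin _ _ (dominated_slice t dg) => /le_trans; apply.
by rewrite mulrAC ler_norm.
Qed.

Let RintRnS_aux n : fin_bound n -> seq_cvg n -> forall C (g : 'rV[R]_n.+1 -> R),
  dominated C g ->
  intRn (fun y => (g y)%:E) =
  (\int[mu]_t (RintRn (fun v => g (cons_rV t v)))%:E)%E.
Proof.
move=> fin dct C g dg /=; apply: eq_integral => t _.
by have [-> _] := fin _ _ (dominated_slice t dg).
Qed.

(* Finiteness and dominated convergence have to be proved together: convergence in
   dimension n makes the inner integral of dimension n + 1 continuous, hence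
   measurable, in the outer variable. *)
Let fin_dct n : fin_bound n /\ seq_cvg n.
Proof.
elim: n => [|n [fin dct]].
  split=> [C g [cg C0 gC]|C g_ g _ _ gg].
    by split=> //; rewrite /RintRn/=; have := gC 0; rewrite /prodk big_ord0.
  exact: gg.
have finS : fin_bound n.+1.
  move=> C g dg; rewrite /RintRn (RintRnS_aux fin dct dg).
  have ig := slice_integrable fin dct dg.
  split; first by rewrite fineK// integrable_fin_num.
  apply: le_trans (le_normr_Rintegral measurableT ig) _.
  rewrite exprSr mulrA -RintegralZl//.
  apply: le_Rintegral => //.
  - exact: (integrable_norm ig).
  - exact: integrableZk.
  - move=> t _; have [_] := fin _ _ (dominated_slice t dg) => /le_trans; apply.
    by rewrite mulrAC.
split=> // C g_ g dg_ dg gg.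
rewrite /RintRn (RintRnS_aux fin dct dg).
under eq_fun do rewrite (RintRnS_aux fin dct (dg_ _)).
apply: fine_cvg; rewrite fineK; last first.
  by rewrite integrable_fin_num//; exact: slice_integrable dg.
have [] // := @dominated_convergence _ _ R mu setT measurableT
  (fun m t => (RintRn (fun v => g_ m (cons_rV t v)))%:E)
  (fun t => (RintRn (fun v => g (cons_rV t v)))%:E)
  (fun t => (C * K ^+ n * k t)%:E).
- move=> m; apply/measurable_EFinP; apply: continuous_measurable_fun.
  exact: slice_continuous (dg_ m).
- apply/measurable_EFinP; apply: continuous_measurable_fun.
  exact: slice_continuous dg.
- apply: aeW => t _; apply: cvg_EFin; first by apply: nearW.
  apply: (dct (C * k t)).
  + by move=> m; exact: dominated_slice.
  + exact: dominated_slice.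
  + by move=> v; exact: gg.
- apply: aeW => t m _; rewrite /= lee_fin.
  have [_] := fin _ _ (dominated_slice t (dg_ m)) => /le_trans; apply.
  by rewrite mulrAC.
Qed.

Lemma RintRnS n C (g : 'rV[R]_n.+1 -> R) : dominated C g ->
  RintRn g = (\int[mu]_t RintRn (fun v => g (cons_rV t v)))%R.
Proof.
by have [fin dct] := fin_dct n; move=> dg; rewrite {1}/RintRn (RintRnS_aux fin dct dg).
Qed.

Let RintRn_slice_integrable n C (g : 'rV[R]_n.+1 -> R) : dominated C g ->
  mu.-integrable setT (fun t => (RintRn (fun v => g (cons_rV t v)))%:E).
Proof. by have [fin dct] := fin_dct n; exact: slice_integrable. Qed.

Lemma dominatedM n C (g : 'rV[R]_n -> R) a : dominated C g ->
  dominated (`|a| * C) (fun y => a * g y).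
Proof.
case=> cg C0 gC; split; [|exact: mulr_ge0|].
  by move=> y; apply: continuousM; [exact: cst_continuous|exact: cg].
by move=> y; rewrite normrM -mulrA ler_wpM2l.
Qed.

Lemma dominatedD n C D (g h : 'rV[R]_n -> R) : dominated C g -> dominated D h ->
  dominated (C + D) (fun y => g y + h y).
Proof.
case=> cg C0 gC [ch D0 hD]; split; [|exact: addr_ge0|].
  by move=> y; apply: continuousD; [exact: cg|exact: ch].
by move=> y; rewrite mulrDl (le_trans (ler_normD _ _))// lerD.
Qed.

Lemma RintRnZ n C (g : 'rV[R]_n -> R) a : dominated C g ->
  RintRn (fun y => a * g y) = a * RintRn g.
Proof.
elim: n C g => [//|n IH] C g dg.
rewrite (RintRnS (dominatedM a dg)) (RintRnS dg) -RintegralZl//; last first.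
  exact: RintRn_slice_integrable dg.
by apply: eq_Rintegral => t _; exact: IH (dominated_slice t dg).
Qed.

Lemma RintRnD n C D (g h : 'rV[R]_n -> R) : dominated C g -> dominated D h ->
  RintRn (fun y => g y + h y) = RintRn g + RintRn h.
Proof.
elim: n C D g h => [//|n IH] C D g h dg dh.
rewrite (RintRnS (dominatedD dg dh)) (RintRnS dg) (RintRnS dh) -RintegralD//.
- apply: eq_Rintegral => t _.
  exact: IH (dominated_slice t dg) (dominated_slice t dh).
- exact: RintRn_slice_integrable dg.
- exact: RintRn_slice_integrable dh.
Qed.

Lemma RintRn_ge0 n C (g : 'rV[R]_n -> R) : dominated C g ->
  (forall y, 0 <= g y) -> 0 <= RintRn g.
Proof.
elim: n C g => [|n IH] C g dg g0; first exact: g0.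
rewrite (RintRnS dg); apply: Rintegral_ge0 => t _.
by apply: IH (dominated_slice t dg) _ => y.
Qed.

(** By continuity [G] stays above [G t0 / 2] on an interval around [t0], and the integral over that
    interval is already positive. *)
Let Rintegral_gt0 (G : R -> R) t0 : continuous G ->
  mu.-integrable setT (EFin \o G) -> (forall t, 0 <= G t) -> 0 < G t0 ->
  0 < (\int[mu]_t G t)%R.
Proof.
move=> cG iG G0 Gt0.
have /cvgrPdist_lt/(_ (G t0 / 2)) := cG t0.
rewrite divr_gt0// => /(_ isT) /nbhs_ballP[e /= e0 He].
set A := `]t0 - e, t0 + e[%classic.
have mA : measurable (A : set (measurableTypeR R)) by exact: measurable_itv.
have iGA : mu.-integrable A (EFin \o G) by exact: integrableS iG.
have HA t : A t -> G t0 / 2 <= G t.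
  move=> At; have /He : ball t0 e t by rewrite ball_itv.
  by move=> /= /ltr_distlDr; lra.
have muA : mu A = (2 * e)%:E.
  rewrite /A lebesgue_measure_itv/= lte_fin ifT; last by lra.
  by rewrite -EFinB; congr (_%:E); lra.
apply: (@lt_le_trans _ _ (\int[mu]_(t in A) (G t0 / 2))%R).
  rewrite Rintegral_cst// [fine _](congr1 fine muA)/=.
  by rewrite mulr_gt0// ?divr_gt0// mulr_gt0.
apply: (@le_trans _ _ (\int[mu]_(t in A) G t)%R).
  apply: le_Rintegral => //.
  apply/integrableP; split; first by apply/measurable_EFinP.
  by rewrite /= integral_cst// [X in (_ * X)%E]muA -EFinM ltry.
rewrite /Rintegral fine_le//.
- by apply: integrable_fin_num => //; exact: iGA.
- exact: integrable_fin_num.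
- apply: ge0_subset_integral => //.
  + by case/integrableP: iG.
  + by move=> t _; rewrite lee_fin.
Qed.

(** By induction the slice through [y0] has a positive integral, and slice integrals are
    non-negative and continuous in the outer variable. *)
Lemma RintRn_gt0 n C (g : 'rV[R]_n -> R) y0 : dominated C g ->
  (forall y, 0 <= g y) -> 0 < g y0 -> 0 < RintRn g.
Proof.
elim: n C g y0 => [|n IH] C g y0 dg g0 gy0.
  by rewrite /RintRn/= -(_ : y0 = 0)//; apply/rowP => -[].
rewrite (RintRnS dg); apply: (@Rintegral_gt0 _ (y0 ord0 ord0)).
- by have [_ dct] := fin_dct n; exact: slice_continuous dg.
- exact: RintRn_slice_integrable dg.
- by move=> t; apply: RintRn_ge0 (dominated_slice t dg) _ => y.
- apply: (IH _ _ (\row_j y0 ord0 (lift ord0 j))).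
  + exact: dominated_slice dg.
  + by move=> y.
  + by rewrite cons_rVK.
Qed.

End iterated_integral.

(** * Functions of at most exponential growth *)

Section exp_bounds.
Context {R : realType}.
Implicit Types u : R.

Lemma le1Dx_expR u : 1 + u <= expR u.
Proof.
by have [->|/expR_gt1Dx/ltW//] := eqVneq u 0; rewrite addr0 expR0.
Qed.

(** For [u >= 0] this is [1 - u <= expR (- u)] multiplied by [expR u]; for [u < 0] it follows from
    [1 + u <= expR u]. *)
Lemma norm_expRB1 u : `|expR u - 1| <= `|u| * expR `|u|.
Proof.
have [u0|u0] := leP 0 u.
  rewrite ger0_norm ?subr_ge0 -?expR0 ?ler_expR// ger0_norm// expR0.
  have := le1Dx_expR (- u); have := expR_gt0 u.
  have : expR u * expR (- u) = 1 by rewrite -expRD subrr expR0.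
  by nra.
rewrite ler0_norm; last by rewrite subr_le0 -expR0 ler_expR ltW.
have := le1Dx_expR u.
have : 1 <= expR `|u| by rewrite -expR0 ler_expR.
by rewrite (ltr0_norm u0); nra.
Qed.

(** The remainder is non-negative and, since [expR u - 1 <= u * expR u], at most [u * (expR u - 1)];
    the sign of [u] decides how the second factor is bounded. *)
Lemma norm_expRB1B u : `|expR u - 1 - u| <= u ^+ 2 * expR `|u|.
Proof.
have e1 := le1Dx_expR u; rewrite ger0_norm; last by lra.
have eM : expR u - 1 <= u * expR u.
  have := le1Dx_expR (- u); have := expR_gt0 u.
  have : expR u * expR (- u) = 1 by rewrite -expRD subrr expR0.
  by nra.
apply: (@le_trans _ _ (u * (expR u - 1))); first by lra.
rewrite expr2 -mulrA; have [u0|u0] := leP 0 u.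
  by rewrite ger0_norm// ler_wpM2l.
rewrite ler_nM2l//.
have : 1 <= expR `|u| by rewrite -expR0 ler_expR.
by nra.
Qed.

End exp_bounds.

Section moderate_growth.
Context {R : realType} {n : nat}.
Implicit Types (x y : 'rV[R]_n) (g h : 'rV[R]_n -> R).

Definition dotv x y := \sum_(i < n) x ord0 i * y ord0 i.

(** The l1 norm is used to measure growth because its exponential factorises over the coordinates,
    as product kernels do. *)
Definition norm1 y := \sum_(i < n) `|y ord0 i|.

Lemma norm1_ge0 y : 0 <= norm1 y.
Proof. by apply: sumr_ge0. Qed.

Lemma norm_coord y i : `|y ord0 i| <= `|y|.
Proof.
rewrite [leRHS]/Num.norm/= mx_normrE.
by apply/bigmax_geP; right => /=; exists (ord0, i).
Qed.

Lemma norm_coord1 y i : `|y ord0 i| <= norm1 y.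
Proof. by rewrite /norm1 (bigD1 i)//= lerDl sumr_ge0. Qed.

(** Hölder's inequality, the norm on row vectors being the max norm. *)
Lemma norm_dotv x y : `|dotv x y| <= `|x| * norm1 y.
Proof.
rewrite /dotv /norm1 mulr_sumr; apply: le_trans (ler_norm_sum _ _ _) _.
by apply: ler_sum => i _; rewrite normrM ler_wpM2r// norm_coord.
Qed.

Lemma dotvDl x x' y : dotv (x + x') y = dotv x y + dotv x' y.
Proof. by rewrite -big_split; apply: eq_bigr => i _; rewrite mxE mulrDl. Qed.

Lemma dotvZl a x y : dotv (a *: x) y = a * dotv x y.
Proof. by rewrite mulr_sumr; apply: eq_bigr => i _; rewrite mxE mulrA. Qed.

Lemma dotv0l y : dotv 0 y = 0.
Proof. by apply: big1 => i _; rewrite mxE mul0r. Qed.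

Lemma dotvC x y : dotv x y = dotv y x.
Proof. by apply: eq_bigr => i _; rewrite mulrC. Qed.

Lemma dotvBl x x' y : dotv (x - x') y = dotv x y - dotv x' y.
Proof. by rewrite dotvDl -[- x']scaleN1r dotvZl mulN1r. Qed.

Lemma dotvBr x x' y : dotv y (x - x') = dotv y x - dotv y x'.
Proof. by rewrite dotvC dotvBl !(dotvC y). Qed.

Lemma dotv_delta i y : dotv (delta_mx ord0 i) y = y ord0 i.
Proof.
rewrite /dotv (bigD1 i)//= big1 ?addr0 ?mxE ?eqxx ?mul1r// => j ji.
by rewrite mxE (negbTE ji) andbF mul0r.
Qed.

Lemma sqnormE y : sqnorm y = dotv y y.
Proof. by apply: eq_bigr => i _; rewrite expr2. Qed.

Lemma sqnormB x y : sqnorm (x - y) = sqnorm x - 2 * dotv x y + sqnorm y.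
Proof. by rewrite !sqnormE dotvBl !dotvBr (dotvC y x); lra. Qed.

Lemma sqnorm_gt0 x : x != 0 -> 0 < sqnorm x.
Proof.
move=> x0; rewrite lt_neqAle sumr_ge0 ?andbT; last by move=> i _; exact: sqr_ge0.
apply: contra_neq x0 => /esym/eqP; rewrite psumr_eq0; last first.
  by move=> i _; exact: sqr_ge0.
move=> /allP x0; apply/rowP => i; apply/eqP; rewrite mxE -sqrf_eq0.
by apply: x0; rewrite mem_index_enum.
Qed.

Lemma continuous_norm1 : continuous norm1.
Proof.
apply: continuous_big => [|i _]; first exact: add_continuous.
move=> y; apply: (@continuous_comp _ _ _ (fun y : 'rV_n => y ord0 i) (fun t : R => `|t|)).
  exact: coord_continuous.
exact: norm_continuous.
Qed.

Lemma continuous_dotv x : continuous (dotv x).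
Proof.
apply: continuous_big => [|i _]; first exact: add_continuous.
move=> y; apply: continuousM; first exact: cst_continuous.
exact: coord_continuous.
Qed.

Lemma continuous_sqnorm : continuous (@sqnorm R n).
Proof.
apply: continuous_big => [|i _]; first exact: add_continuous.
move=> y; apply: (@continuous_comp _ _ _ (fun y : 'rV_n => y ord0 i) (fun t : R => t ^+ 2)).
  exact: coord_continuous.
exact: exprn_continuous.
Qed.

(** This class is closed under sums and products and contains the coordinates and the exponentials
    of linear forms, hence every integrand produced by differentiation. *)
Definition moderate h := continuous h /\
  exists C B, [/\ 0 <= C, 0 <= B & forall y, `|h y| <= C * expR (B * norm1 y)].

Lemma moderate_le g h : continuous g -> moderate h ->
  (forall y, `|g y| <= `|h y|) -> moderate g.
Proof.
move=> cg [_ [C [B [C0 B0 hB]]]] gh; split => //; exists C, B; split => // y.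
exact: le_trans (gh y) (hB y).
Qed.

Lemma moderateD g h : moderate g -> moderate h -> moderate (fun y => g y + h y).
Proof.
move=> [cg [C [B [C0 B0 gB]]]] [ch [C' [B' [C'0 B'0 hB]]]]; split.
  by move=> y; apply: continuousD; [exact: cg|exact: ch].
exists (C + C'), (B + B'); split; [exact: addr_ge0|exact: addr_ge0|].
move=> y; apply: le_trans (ler_normD _ _) _; rewrite [leRHS]mulrDl; apply: lerD.
  apply: le_trans (gB y) _; rewrite ler_wpM2l// ler_expR ler_wpM2r ?norm1_ge0//.
  by rewrite lerDl.
apply: le_trans (hB y) _; rewrite ler_wpM2l// ler_expR ler_wpM2r ?norm1_ge0//.
by rewrite lerDr.
Qed.

Lemma moderateM g h : moderate g -> moderate h -> moderate (fun y => g y * h y).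
Proof.
move=> [cg [C [B [C0 B0 gB]]]] [ch [C' [B' [C'0 B'0 hB]]]]; split.
  by move=> y; apply: continuousM; [exact: cg|exact: ch].
exists (C * C'), (B + B'); split; [exact: mulr_ge0|exact: addr_ge0|].
by move=> y; rewrite normrM mulrDl expRD mulrACA; apply: ler_pM.
Qed.

Lemma moderate_cst c : moderate (fun=> c).
Proof.
split; first exact: cst_continuous.
by exists `|c|, 0; split=> // y; rewrite mul0r expR0 mulr1.
Qed.

Lemma moderateN h : moderate h -> moderate (fun y => - h y).
Proof.
move=> [ch hB]; apply: moderate_le (conj ch hB) _.
  by move=> y; apply: continuousN; exact: ch.
by move=> y; rewrite normrN.
Qed.

Lemma moderate_norm h : moderate h -> moderate (fun y => `|h y|).
Proof.
move=> mh; apply: (moderate_le _ mh) => [y|y]; last by rewrite normr_id.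
apply: (@continuous_comp _ _ _ h (fun t : R => `|t|)); first by case: mh => + _; exact.
exact: norm_continuous.
Qed.

Lemma moderate_expR_norm1 a : 0 <= a -> moderate (fun y => expR (a * norm1 y)).
Proof.
move=> a0; split.
  move=> y; apply: (@continuous_comp _ _ _ (fun y => a * norm1 y) expR).
    by apply: continuousM; [exact: cst_continuous|exact: continuous_norm1].
  exact: continuous_expR.
by exists 1, a; split=> // y; rewrite mul1r ger0_norm// expR_ge0.
Qed.

Lemma moderate_norm1 : moderate norm1.
Proof.
apply: moderate_le continuous_norm1 (moderate_expR_norm1 ler01) _ => y.
rewrite ger0_norm ?norm1_ge0// ger0_norm ?expR_ge0// mul1r.
by have := le1Dx_expR (norm1 y); lra.
Qed.

Lemma moderate_coord i : moderate (fun y => y ord0 i).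
Proof.
apply: moderate_le moderate_norm1 _; first exact: coord_continuous.
by move=> y; rewrite (ger0_norm (norm1_ge0 y)) norm_coord1.
Qed.

Lemma moderate_dotv x : moderate (dotv x).
Proof.
apply: moderate_le (moderateM (moderate_cst `|x|) moderate_norm1) _.
  exact: continuous_dotv.
move=> y; rewrite [leRHS]ger0_norm ?norm_dotv//.
by rewrite mulr_ge0// norm1_ge0.
Qed.

Lemma moderate_expR_dotv s x : moderate (fun y => expR (dotv x y / s)).
Proof.
have mE := @moderate_expR_norm1 (`|x| * `|s^-1|) (mulr_ge0 (normr_ge0 _) (normr_ge0 _)).
apply: moderate_le mE _.
  move=> y; apply: (@continuous_comp _ _ _ (fun y => dotv x y / s) expR).
    by apply: continuousM; [exact: continuous_dotv|exact: cst_continuous].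
  exact: continuous_expR.
move=> y; rewrite !(ger0_norm (expR_ge0 _)) ler_expR mulrAC.
apply: le_trans (ler_norm _) _; rewrite normrM ler_wpM2r//.
exact: norm_dotv.
Qed.

End moderate_growth.

(** * The one-dimensional Gaussian dominating kernel *)

Section gaussian_kernel.
Context {R : realType}.
Variable s : R.
Hypothesis s0 : 0 < s.
Local Notation mu := (@lebesgue_measure R).

(** Half the exponent of the Gaussian of variance [s]; the other half is kept to absorb exponential
    growth. *)
Definition gkern (t : R) := expR (- t ^+ 2 / (4 * s)).

Lemma gkern_ge0 t : 0 <= gkern t. Proof. exact: expR_ge0. Qed.

Lemma gkern_le1 t : gkern t <= 1.
Proof.
rewrite -expR0 ler_expR mulNr oppr_le0 divr_ge0// ?sqr_ge0// mulr_ge0//.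
exact: ltW.
Qed.

(** Up to its peak value, [gkern] is the centred normal density of variance [2 * s]. *)
Lemma gkern_integrable : mu.-integrable setT (EFin \o gkern).
Proof.
set sg := Num.sqrt (2 * s).
have sg0 : sg != 0 by rewrite gt_eqF// sqrtr_gt0 mulr_gt0.
rewrite (_ : _ \o _ = fun t => ((normal_peak sg)^-1%:E * (normal_pdf 0 sg t)%:E)%E).
  by apply: integrableZl => //; exact: integrable_normal_pdf.
apply/funext => t; rewrite -EFinM /= normal_pdfE//=.
rewrite mulKf ?gt_eqF ?normal_peak_gt0// /normal_fun subr0 /sg sqr_sqrtr.
  by congr (expR _)%:E; congr (_ / _); lra.
by rewrite mulr_ge0// ltW.
Qed.

(** Completing the square. *)
Lemma gauss_le_gkern B t : - t ^+ 2 / (2 * s) + B * `|t| <= s * B ^+ 2 + - t ^+ 2 / (4 * s).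
Proof.
rewrite -subr_ge0.
have -> : s * B ^+ 2 + - t ^+ 2 / (4 * s) - (- t ^+ 2 / (2 * s) + B * `|t|) =
    (`|t| - 2 * s * B) ^+ 2 / (4 * s).
  by rewrite -[t ^+ 2]real_normK ?num_real//; field; rewrite gt_eqF.
by rewrite divr_ge0 ?sqr_ge0// mulr_ge0// ltW.
Qed.

End gaussian_kernel.

(** * Integrals against the Gaussian-weighted density *)

Lemma locally_lipschitz_continuous (R : realType) (V : normedModType R) (f : V -> R) :
  (forall x, exists M, forall x', `|x' - x| <= 1 -> `|f x' - f x| <= M * `|x' - x|) ->
  continuous f.
Proof.
move=> lf x; have [M HM] := lf x.
apply/cvgrPdist_lt => e e0.
have M0 : 0 < `|M| + 1 by rewrite ltr_wpDl.
have d0 : 0 < Num.min 1 (e / (`|M| + 1)) by rewrite lt_min ltr01 divr_gt0.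
near=> x'.
have : `|x - x'| < Num.min 1 (e / (`|M| + 1)).
  by near: x'; apply: cvgr_dist_lt d0; exact: cvg_id.
rewrite (distrC x) (distrC (f x)) lt_min => /andP[/ltW x1 xe].
apply: le_lt_trans (HM _ x1) _; move: xe; rewrite ltr_pdivlMr// => /(le_lt_trans _); apply.
by rewrite mulrC ler_wpM2l//; have := ler_norm M; lra.
Unshelve. all: by end_near.
Qed.

Section weighted_integral.
Context {R : realType} {n : nat}.
Variables (s W : R) (w : 'rV[R]_n -> R).
Hypotheses (s0 : 0 < s) (cw : continuous w).
Hypotheses (w0 : forall y, 0 < w y) (wW : forall y, w y <= W).
Implicit Types (x y z : 'rV[R]_n) (g h : 'rV[R]_n -> R).

(** The Gaussian is centred at 0 whatever [x] is: the dependence on [x] is carried by the factor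
    [expR (dotv x y / s)] of the integrand, so all integrals share one weight. *)
Let gauss y := expR (- sqnorm y / (2 * s)) * w y.

Let gauss_gt0 y : 0 < gauss y.
Proof. by rewrite mulr_gt0// expR_gt0. Qed.

Definition wint h := RintRn (fun y => gauss y * h y).

(** [W] bounds [w], [C * expR (B * norm1 y)] bounds [h], and [gauss_le_gkern] in each coordinate
    contributes one of the [n] factors [expR (s * B ^+ 2)]. *)
Let dominated_gauss h : moderate h ->
  exists C, dominated (gkern s) C (fun y => gauss y * h y).
Proof.
move=> [ch [C [B [C0 B0 hB]]]].
have W0 : 0 <= W by exact: le_trans (ltW (w0 0)) (wW 0).
exists (W * C * expR (s * B ^+ 2) ^+ n); split.
- move=> y; apply: (@continuousM _ _ (fun y => gauss y) h); last exact: ch.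
  apply: (@continuousM _ _ (fun y => expR (- sqnorm y / (2 * s))) w); last exact: cw.
  apply: (@continuous_comp _ _ _ (fun y => - sqnorm y / (2 * s)) expR); last first.
    exact: continuous_expR.
  apply: continuousM; last exact: cst_continuous.
  by apply: continuousN; exact: continuous_sqnorm.
- by rewrite !mulr_ge0// exprn_ge0// expR_ge0.
- move=> y; rewrite normrM gtr0_norm// /gauss.
  apply: (@le_trans _ _ ((expR (- sqnorm y / (2 * s)) * W) * (C * expR (B * norm1 y)))).
    by apply: ler_pM => //; [exact: ltW (gauss_gt0 y)|rewrite ler_wpM2l// expR_ge0].
  rewrite [leLHS](_ : _ = W * C * (expR (- sqnorm y / (2 * s)) * expR (B * norm1 y))); last by ring.
  rewrite -[leRHS]mulrA ler_wpM2l ?mulr_ge0// -expRD.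
  rewrite (_ : expR _ ^+ n = \prod_(i < n) expR (s * B ^+ 2)); last first.
    by rewrite prodr_const card_ord.
  rewrite -big_split/= /gkern; under eq_bigr do rewrite -expRD.
  rewrite -expR_sum ler_expR /norm1 mulr_sumr mulNr mulr_suml -sumrN -big_split/=.
  apply: ler_sum => i _; rewrite -mulNr; exact: gauss_le_gkern.
Qed.

Let kge0 := @gkern_ge0 R s.
Let kle1 := gkern_le1 s0.
Let kint := gkern_integrable s0.

Lemma wintZ a h : moderate h -> wint (fun y => a * h y) = a * wint h.
Proof.
move=> /dominated_gauss[C dC]; rewrite /wint -(RintRnZ kge0 kle1 kint a dC).
by congr RintRn; apply/funext => y; ring.
Qed.

Lemma wintD g h : moderate g -> moderate h ->
  wint (fun y => g y + h y) = wint g + wint h.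
Proof.
move=> /dominated_gauss[C dC] /dominated_gauss[D dD].
rewrite /wint -(RintRnD kge0 kle1 kint dC dD).
by congr RintRn; apply/funext => y; ring.
Qed.

Lemma wintB g h : moderate g -> moderate h ->
  wint (fun y => g y - h y) = wint g - wint h.
Proof.
move=> mg mh; rewrite wintD//; last exact: moderateN.
rewrite -[X in _ + X = _](_ : wint (fun y => -1 * h y) = _); first by rewrite wintZ// mulN1r.
by congr wint; apply/funext => y; rewrite mulN1r.
Qed.

Lemma wint_ge0 h : moderate h -> (forall y, 0 <= h y) -> 0 <= wint h.
Proof.
move=> /dominated_gauss[C dC] h0; apply: (RintRn_ge0 kge0 kle1 kint dC) => y.
by rewrite mulr_ge0// ltW.
Qed.

Lemma wint_gt0 h y0 : moderate h -> (forall y, 0 <= h y) -> 0 < h y0 -> 0 < wint h.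
Proof.
move=> /dominated_gauss[C dC] h0 hy0.
apply: (RintRn_gt0 kge0 kle1 kint (y0 := y0) dC) => [y|].
  by rewrite mulr_ge0// ltW.
by rewrite mulr_gt0.
Qed.

Lemma le_wint g h : moderate g -> moderate h -> (forall y, g y <= h y) ->
  wint g <= wint h.
Proof.
move=> mg mh gh; rewrite -subr_ge0 -wintB//; apply: wint_ge0.
  by apply: moderateD => //; exact: moderateN.
by move=> y; rewrite subr_ge0.
Qed.

Lemma norm_wint g h : moderate g -> moderate h -> (forall y, `|g y| <= h y) ->
  `|wint g| <= wint h.
Proof.
move=> mg mh gh; rewrite ler_norml -mulN1r -wintZ//; apply/andP; split.
  apply: le_wint => // [|y]; first by apply: moderateM => //; exact: moderate_cst.
  by rewrite mulN1r; have := gh y; rewrite ler_norml => /andP[].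
by apply: le_wint => // y; exact: le_trans (ler_norm _) (gh y).
Qed.

Lemma wint_sum (F : 'I_n -> 'rV[R]_n -> R) : (forall i : 'I_n, moderate (F i)) ->
  forall r : seq 'I_n, moderate (fun y => \sum_(i <- r) F i y) /\
  wint (fun y => \sum_(i <- r) F i y) = \sum_(i <- r) wint (F i).
Proof.
move=> mF; elim=> [|i r [mr IH]].
  under eq_fun do rewrite big_nil; rewrite big_nil; split; first exact: moderate_cst.
  rewrite -[LHS](_ : wint (fun=> 0 * 1) = _); last by under eq_fun do rewrite mul0r.
  by rewrite wintZ ?mul0r//; exact: moderate_cst.
under eq_fun do rewrite big_cons; rewrite big_cons -IH.
by split; [exact: moderateD|rewrite wintD].
Qed.

Definition laplace h x := wint (fun y => expR (dotv x y / s) * h y).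

Let moderate_exp h x : moderate h -> moderate (fun y => expR (dotv x y / s) * h y).
Proof. by move=> mh; apply: moderateM => //; exact: moderate_expR_dotv. Qed.

Lemma laplace_gt0 h x y0 : moderate h -> (forall y, 0 <= h y) -> 0 < h y0 ->
  0 < laplace h x.
Proof.
move=> mh h0 hy0; apply: (@wint_gt0 _ y0); first exact: moderate_exp.
  by move=> y; rewrite mulr_ge0// expR_ge0.
by rewrite mulr_gt0// expR_gt0.
Qed.

Lemma laplace1_gt0 x : 0 < laplace (fun=> 1) x.
Proof. by apply: (@laplace_gt0 _ x 0) => //; exact: moderate_cst. Qed.

(** The integrands differ by the factor [expR b - 1] with [b = dotv (x' - x) y / s], at most
    [|b| * expR |b|] in absolute value. The first factor yields [|x' - x|]; the restriction to the
    unit ball bounds the second independently of [x']. *)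
Lemma laplace_lipschitz h x : moderate h ->
  exists M, forall x', `|x' - x| <= 1 -> `|laplace h x' - laplace h x| <= M * `|x' - x|.
Proof.
move=> mh.
pose G y := expR (dotv x y / s) * `|h y| * (norm1 y / s * expR (s^-1 * norm1 y)).
have mG : moderate G.
  apply: moderateM; first by apply: moderate_exp; exact: moderate_norm.
  apply: moderateM; last by apply: moderate_expR_norm1; rewrite invr_ge0 ltW.
  by apply: moderateM; [exact: moderate_norm1|exact: moderate_cst].
exists (wint G) => x' x'x.
rewrite -wintB; [|exact: moderate_exp|exact: moderate_exp].
rewrite mulrC -wintZ//; apply: norm_wint.
- by apply: moderateD; [exact: moderate_exp|apply: moderateN; exact: moderate_exp].
- by apply: moderateM => //; exact: moderate_cst.
move=> y; set b := dotv (x' - x) y / s.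
have bE : `|b| <= `|x' - x| * (norm1 y / s).
  rewrite /b normrM (gtr0_norm (x := s^-1)) ?invr_gt0// mulrA.
  by rewrite ler_wpM2r ?norm_dotv// invr_ge0 ltW.
have n0 : 0 <= norm1 y / s by rewrite divr_ge0 ?norm1_ge0 ?ltW.
have bs : `|b| <= s^-1 * norm1 y.
  by rewrite mulrC; apply: le_trans bE _; rewrite ler_piMl.
have -> : expR (dotv x' y / s) = expR (dotv x y / s) * expR b.
  by rewrite -expRD /b dotvBl; congr expR; field; rewrite gt_eqF.
rewrite [X in `|X|](_ : _ = expR (dotv x y / s) * h y * (expR b - 1)); last by ring.
rewrite !normrM (gtr0_norm (expR_gt0 _)) /G mulrCA ler_wpM2l ?mulr_ge0 ?expR_ge0//.
apply: le_trans (norm_expRB1 _) _; rewrite mulrA; apply: ler_pM => //.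
by rewrite ler_expR.
Qed.

Lemma laplace_continuous h : moderate h -> continuous (laplace h).
Proof.
by move=> mh; apply: locally_lipschitz_continuous => x; exact: laplace_lipschitz.
Qed.

(** A first-order expansion with quadratic remainder, which takes the place of differentiation under
    the integral sign. The remainder of the integrand is [expR b - 1 - b] with [b] linear in [t]. *)
Lemma laplace_quadratic h x i : moderate h ->
  exists M, forall t : R, `|t| <= 1 ->
  `|laplace h (t *: delta_mx ord0 i + x) - laplace h x
    - t * laplace (fun y => y ord0 i / s * h y) x| <= M * t ^+ 2.
Proof.
move=> mh.
pose G y := expR (dotv x y / s) * `|h y| * ((norm1 y / s) ^+ 2 * expR (s^-1 * norm1 y)).
have mG : moderate G.
  apply: moderateM; first by apply: moderate_exp; exact: moderate_norm.
  apply: moderateM; last by apply: moderate_expR_norm1; rewrite invr_ge0 ltW.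
  have mN : moderate (fun y : 'rV[R]_n => norm1 y / s).
    by apply: moderateM; [exact: moderate_norm1|exact: moderate_cst].
  exact: (moderateM mN mN).
have mi : moderate (fun y : 'rV[R]_n => y ord0 i / s * h y).
  apply: moderateM => //; apply: moderateM; first exact: moderate_coord.
  exact: moderate_cst.
have mti (t : R) : moderate (fun y => t * (expR (dotv x y / s) * (y ord0 i / s * h y))).
  by apply: moderateM; [exact: moderate_cst|exact: moderate_exp].
exists (wint G) => t t1; set x' := _ + x.
have mB : moderate (fun y => expR (dotv x' y / s) * h y - expR (dotv x y / s) * h y).
  by apply: moderateD; [exact: moderate_exp|apply: moderateN; exact: moderate_exp].
rewrite -wintB; [|exact: moderate_exp|exact: moderate_exp].
rewrite -wintZ; last exact: moderate_exp.
rewrite -wintB// mulrC -wintZ//; apply: norm_wint.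
- by apply: moderateD => //; exact: moderateN.
- by apply: moderateM => //; exact: moderate_cst.
move=> y; set b := t * (y ord0 i / s).
have n0 : 0 <= norm1 y / s by rewrite divr_ge0 ?norm1_ge0 ?ltW.
have bE : `|b| <= `|t| * (norm1 y / s).
  rewrite /b normrM ler_wpM2l// normrM (gtr0_norm (x := s^-1)) ?invr_gt0//.
  by rewrite ler_wpM2r ?norm_coord1// invr_ge0 ltW.
have bs : `|b| <= s^-1 * norm1 y.
  by rewrite mulrC; apply: le_trans bE _; rewrite ler_piMl.
have -> : expR (dotv x' y / s) = expR (dotv x y / s) * expR b.
  rewrite -expRD /x' /b dotvDl dotvZl dotv_delta; congr expR.
  by field; rewrite gt_eqF.
rewrite [X in `|X|](_ : _ = expR (dotv x y / s) * h y * (expR b - 1 - b)); last first.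
  by rewrite /b; ring.
rewrite !normrM (gtr0_norm (expR_gt0 _)) /G mulrCA ler_wpM2l ?mulr_ge0 ?expR_ge0//.
apply: le_trans (norm_expRB1B _) _; rewrite mulrA; apply: ler_pM => //.
- exact: sqr_ge0.
- rewrite -[b ^+ 2]real_normK ?num_real// -[t ^+ 2]real_normK ?num_real//.
  by rewrite -exprMn lerXn2r// nnegrE mulr_ge0.
- by rewrite ler_expR.
Qed.

End weighted_integral.

(** * Smoothness *)

Lemma quadratic_is_derive (R : realType) (V : normedModType R) (f : V -> R)
    (x v : V) (D M : R) :
  (forall t : R, `|t| <= 1 -> `|f (t *: v + x) - f x - t * D| <= M * t ^+ 2) ->
  is_derive x v f D.
Proof.
move=> fM.
suff cv : (fun t => t^-1 *: ((f \o shift x) (t *: v) - f x)) @ 0^' --> D.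
  by split; [exact: cvgP cv|exact: cvg_lim cv].
apply/cvgrPdist_lt => e e0.
have M0 : 0 < `|M| + 1 by rewrite ltr_wpDl.
have d0 : 0 < Num.min 1 (e / (`|M| + 1)) by rewrite lt_min ltr01 divr_gt0.
near=> t.
have t0 : t != 0 by near: t; exact: nbhs_dnbhs_neq.
have : `|t| < Num.min 1 (e / (`|M| + 1)) by near: t; exact: dnbhs0_lt.
rewrite lt_min ltr_pdivlMr// => /andP[/ltW t1 te].
rewrite distrC /= (_ : _ - D = t^-1 * (f (t *: v + x) - f x - t * D)); last first.
  by rewrite /GRing.scale/=; field.
rewrite normrM normfV ltr_pdivrMl ?normr_gt0//.
apply: le_lt_trans (fM _ t1) _; rewrite -real_normK ?num_real//.
have : 0 < `|t| by rewrite normr_gt0.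
have := ler_norm M; set T := `|t| in te *; move=> h1 h2.
rewrite expr2 mulrCA ltr_pM2l//; apply: le_lt_trans te.
by rewrite mulrC ler_wpM2l ?ltW//; lra.
Unshelve. all: by end_near.
Qed.

(** The first-order optimality condition. If [D] were non-zero, the test value
    [t = D / (2 * (|M| + |D|))] would give [t * D = 2 * (|M| + |D|) * t ^+ 2], which exceeds
    [M * t ^+ 2]. *)
Lemma linear_le_quadratic (R : realType) (D M : R) :
  (forall t, `|t| <= 1 -> t * D <= M * t ^+ 2) -> D = 0.
Proof.
move=> H; apply/eqP; apply: contraT => D0.
have M0 : 0 < `|M| + `|D| by rewrite ltr_wpDl// normr_gt0.
pose t := D / (2 * (`|M| + `|D|)).
have nt : `|t| <= 1.
  rewrite normrM normfV (gtr0_norm (mulr_gt0 _ M0))// ler_pdivrMr ?mulr_gt0// mul1r.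
  by have := normr_ge0 M; have := normr_ge0 D; lra.
have t0 : t != 0 by rewrite mulf_neq0// invr_neq0// mulf_neq0// gt_eqF.
have := H t nt; have tD : D = t * (2 * (`|M| + `|D|)) by rewrite divfK// mulf_neq0// gt_eqF.
rewrite [in X in X <= _]tD mulrA -expr2 mulrC ler_pM2r ?exprn_even_gt0//.
by have := ler_norm M; have := normr_gt0 D; rewrite D0 => h1 h2 h3; lra.
Qed.

Section smoothness.
Context {R : realType} {n : nat}.
Variables (s W : R) (w : 'rV[R]_n -> R).
Hypotheses (s0 : 0 < s) (cw : continuous w).
Hypotheses (w0 : forall y, 0 < w y) (wW : forall y, w y <= W).
Implicit Types (x y z : 'rV[R]_n) (h : 'rV[R]_n -> R).

Local Notation L := (laplace s w).

(* The algebra generated by Laplace transforms and the inverse of L 1; it is stable under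
   partial derivatives and contains the coordinates of the tilted mean. *)
Inductive laplace_alg : ('rV[R]_n -> R) -> Prop :=
| laplace_alg_cst c : laplace_alg (fun=> c)
| laplace_alg_laplace h : moderate h -> laplace_alg (L h)
| laplace_alg_inv : laplace_alg (fun x => (L (fun=> 1) x)^-1)
| laplace_algD f g : laplace_alg f -> laplace_alg g -> laplace_alg (fun x => f x + g x)
| laplace_algM f g : laplace_alg f -> laplace_alg g -> laplace_alg (fun x => f x * g x).

Let L1_neq0 x : L (fun=> 1) x != 0.
Proof. by rewrite gt_eqF// (laplace1_gt0 s0 cw w0 wW). Qed.

Lemma laplace_alg_continuous f : laplace_alg f -> continuous f.
Proof.
elim=> [c|h mh||{}f g _ cf _ cg|{}f g _ cf _ cg] x.
- exact: cst_continuous.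
- exact: (laplace_continuous s0 cw w0 wW mh).
- apply: continuousV => //; apply: (laplace_continuous s0 cw w0 wW).
  exact: moderate_cst.
- by apply: continuousD; [exact: cf|exact: cg].
- by apply: continuousM; [exact: cf|exact: cg].
Qed.

Let dL i h := L (fun y => y ord0 i / s * h y).

Let moderate_dL i h : moderate h -> moderate (fun y : 'rV[R]_n => y ord0 i / s * h y).
Proof.
move=> mh; apply: moderateM => //; apply: moderateM; first exact: moderate_coord.
exact: moderate_cst.
Qed.

Lemma laplace_is_derive h x i : moderate h ->
  is_derive x (delta_mx ord0 i) (L h) (dL i h x).
Proof.
move=> mh; have [M HM] := laplace_quadratic s0 cw w0 wW x i mh.
exact: quadratic_is_derive HM.
Qed.

Lemma laplace_alg_derive f i : laplace_alg f -> exists2 df, laplace_alg df &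
  forall x, is_derive x (delta_mx ord0 i) f (df x).
Proof.
elim=> [c|h mh||{}f g af [df adf Hf] ag [dg adg Hg]|{}f g af [df adf Hf] ag [dg adg Hg]].
- by exists (fun=> 0); [exact: laplace_alg_cst|move=> x; exact: is_derive_cst].
- exists (dL i h); last by move=> x; exact: laplace_is_derive.
  by apply: laplace_alg_laplace; exact: moderate_dL.
- have m1 : moderate (fun _ : 'rV[R]_n => 1 : R) := moderate_cst 1.
  (* The derivative of an inverse, with its sign and square spelled as products so as to fit the
     constructors of [laplace_alg]. *)
  exists (fun x => - 1 * ((L (fun=> 1) x)^-1 * (L (fun=> 1) x)^-1) * dL i (fun=> 1) x).
    apply: laplace_algM; last by apply: laplace_alg_laplace; exact: moderate_dL.
    apply: laplace_algM; first exact: laplace_alg_cst.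
    by apply: laplace_algM; exact: laplace_alg_inv.
  move=> x; have [dx vx] := laplace_is_derive x i m1.
  split; first exact: derivableV.
  by rewrite deriveV// vx expr2 invfM mulN1r.
- exists (fun x => df x + dg x); first exact: laplace_algD.
  by move=> x; exact: is_deriveD.
- exists (fun x => f x * dg x + g x * df x).
    by apply: laplace_algD; apply: laplace_algM.
  by move=> x; exact: is_deriveM.
Qed.

(** By induction on the list of directions, the coordinates of every iterated partial derivative
    stay in the algebra, whose members are continuous and differentiable along each axis. *)
Lemma laplace_alg_smooth (F : 'rV[R]_n -> 'rV[R]_n) :
  (forall j, laplace_alg (fun x => F x ord0 j)) -> smooth F.
Proof.
move=> aF.
have ader (G : 'rV[R]_n -> 'rV[R]_n) i : (forall j, laplace_alg (fun x => G x ord0 j)) ->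
    forall x, derivable G x (delta_mx ord0 i).
  move=> aG x; apply/derivable_mxP => k j; rewrite (ord1 k).
  by have [dg _ /(_ x)[]] := laplace_alg_derive i (aG j).
have aiter (r : seq 'I_n) j : laplace_alg (fun x => iter_partial r F x ord0 j).
  elim: r j => [|i r IH] j; first exact: aF.
  have [dg adg Hdg] := laplace_alg_derive i (IH j).
  rewrite (_ : (fun _ => _) = dg)//; apply/funext => x /=.
  rewrite derive_mx ?mxE; last exact: ader.
  by have [_] := Hdg x.
move=> r; split; last by move=> i x; exact: ader.
by apply: continuous_row => j; exact: laplace_alg_continuous.
Qed.

End smoothness.

(** * The mean of the exponentially tilted measure *)

Section tilted_mean.
Context {R : realType} {n : nat}.
Variables (s W : R) (w : 'rV[R]_n -> R).
Hypotheses (s0 : 0 < s) (cw : continuous w).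
Hypotheses (w0 : forall y, 0 < w y) (wW : forall y, w y <= W).
Implicit Types (x y z : 'rV[R]_n) (h : 'rV[R]_n -> R).

Local Notation L := (laplace s w).
Local Notation L1 := (L (fun=> 1)).

Definition tilted_mean x : 'rV[R]_n :=
  (L1 x)^-1 *: \row_i L (fun y => y ord0 i) x.

Let L1_gt0 x : 0 < L1 x := laplace1_gt0 s0 cw w0 wW x.

Let moderate_exp h x : moderate h -> moderate (fun y => expR (dotv x y / s) * h y).
Proof. by move=> mh; apply: moderateM => //; exact: moderate_expR_dotv. Qed.

Let tilted_meanE x i : L (fun y => y ord0 i) x = L1 x * tilted_mean x ord0 i.
Proof. by rewrite !mxE mulVKf// gt_eqF. Qed.

Lemma smooth_tilted_mean : smooth tilted_mean.
Proof.
apply: (laplace_alg_smooth s0 cw w0 wW) => j.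
rewrite (_ : (fun _ => _) = fun x => (L1 x)^-1 * L (fun y => y ord0 j) x).
  apply: laplace_algM; first exact: laplace_alg_inv.
  by apply: laplace_alg_laplace; exact: moderate_coord.
by apply/funext => x; rewrite !mxE.
Qed.

Lemma laplace_dotv v x : L (dotv v) x = L1 x * dotv v (tilted_mean x).
Proof.
pose F i y := v ord0 i * (expR (dotv x y / s) * y ord0 i).
have mF i : moderate (F i).
  apply: moderateM; first exact: moderate_cst.
  by apply: moderate_exp; exact: moderate_coord.
rewrite {1}/laplace (_ : (fun _ => _) = fun y => \sum_(i < n) F i y); last first.
  by apply/funext => y; rewrite mulr_sumr; apply: eq_bigr => i _; rewrite /F; ring.
have [_ ->] := wint_sum s0 cw w0 wW mF (index_enum 'I_n).
rewrite mulr_sumr; apply: eq_bigr => i _.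
rewrite /F (wintZ s0 cw w0 wW); last by apply: moderate_exp; exact: moderate_coord.
by rewrite -/(L (fun y => y ord0 i) x) tilted_meanE; ring.
Qed.

(** Integrate [h y = expR u - 1 - u], with [u = dotv v y / s - m], against the tilted measure at
    [x']. As [m] is the mean of [dotv v y / s], the linear term vanishes and
    [expR (- m) * L1 x - L1 x' > 0] remains; then take logarithms. *)
Lemma tilted_mean_convex x x' : x != x' ->
  ln (L1 x') + dotv (x - x') (tilted_mean x') / s < ln (L1 x).
Proof.
move=> xx'; set v := x - x'; set m := _ / s.
have v0 : v != 0 by rewrite subr_eq0.
pose h y := expR (dotv v y / s - m) - 1 - (dotv v y / s - m).
have mv : moderate (fun y => dotv v y / s).
  by apply: moderateM; [exact: moderate_dotv|exact: moderate_cst].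
have hE : h = fun y => expR (- m) * expR (dotv v y / s) + (m - 1 - dotv v y / s).
  by apply/funext => y; rewrite /h expRD; ring.
have mh : moderate h.
  rewrite hE; apply: moderateD.
    by apply: moderateM; [exact: moderate_cst|exact: moderate_expR_dotv].
  by apply: moderateD; [exact: moderate_cst|exact: moderateN].
have h_gt0 y : dotv v y / s != m -> 0 < h y.
  by rewrite -subr_eq0 /h => /expR_gt1Dx; lra.
have h_ge0 y : 0 <= h y by rewrite /h; have := le1Dx_expR (dotv v y / s - m); lra.
(* A point where [dotv v y / s] differs from [m]: the vector [v] if [m = 0], the origin
   otherwise. *)
have [y0 hy0] : exists y0, 0 < h y0.
  have [m0|m0] := eqVneq m 0.
    exists v; apply: h_gt0; rewrite m0 gt_eqF// divr_gt0// -sqnormE.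
    exact: sqnorm_gt0.
  exists 0; apply: h_gt0; by rewrite dotvC dotv0l mul0r eq_sym.
have := laplace_gt0 s0 cw w0 wW x' mh h_ge0 hy0.
have -> : L h x' = expR (- m) * L1 x - L1 x'.
  have m1 : moderate (fun _ : 'rV[R]_n => 1 : R) := moderate_cst 1.
  pose g1 y := expR (- m) * (expR (dotv x y / s) * 1).
  pose g2 y := (m - 1) * (expR (dotv x' y / s) * 1).
  pose g3 y := s^-1 * (expR (dotv x' y / s) * dotv v y).
  have mg1 : moderate g1 by apply: moderateM; [exact: moderate_cst|exact: moderate_exp].
  have mg2 : moderate g2 by apply: moderateM; [exact: moderate_cst|exact: moderate_exp].
  have mg3 : moderate g3.
    by apply: moderateM; [exact: moderate_cst|apply: moderate_exp; exact: moderate_dotv].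
  rewrite {1}/laplace (_ : (fun _ => _) = fun y => g1 y + (g2 y - g3 y)); last first.
    apply/funext => y; rewrite hE /g1 /g2 /g3.
    have -> : expR (dotv x y / s) = expR (dotv x' y / s) * expR (dotv v y / s).
      by rewrite -expRD /v dotvBl; congr expR; field; rewrite gt_eqF.
    by ring.
  rewrite (wintD s0 cw w0 wW)//; last by apply: moderateD => //; exact: moderateN.
  rewrite (wintB s0 cw w0 wW)//.
  rewrite !(wintZ s0 cw w0 wW); [|apply: moderate_exp..] => //; last exact: moderate_dotv.
  rewrite -/(L (dotv v) x') laplace_dotv -/(L1 x) -/(L1 x') /m.
  by field; rewrite gt_eqF.
rewrite subr_gt0 -ltr_ln ?posrE ?mulr_gt0 ?expR_gt0// lnM ?posrE ?expR_gt0// expRK.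
by rewrite addrC ltrBrDr.
Qed.

(** If the two means agree, adding the strict inequalities for [(x, x')] and [(x', x)] cancels the
    linear terms and gives a contradiction. *)
Lemma tilted_mean_inj : injective tilted_mean.
Proof.
move=> x x' xx'; apply/eqP; apply: contraT => nxx'.
have := tilted_mean_convex nxx'; rewrite eq_sym in nxx'.
have := tilted_mean_convex nxx'; rewrite xx' -[x' - x]opprB -scaleN1r dotvZl.
by rewrite mulN1r mulNr; lra.
Qed.

(** * Surjectivity of the tilted mean *)

Section surjectivity.
Variable z : 'rV[R]_n.

(* L x exp (- <x, z> / s) dominates, up to a factor 2s, the integral q x of twice the
   positive part of <x, y - z>, which is positively homogeneous and positive off 0. *)
Let p x y := dotv x y - dotv x z.
Let q x := wint s w (fun y => `|p x y| + p x y).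
Let Lam x := expR (- (dotv z x / s)) * L1 x.

Let moderate_p x : moderate (p x).
Proof. by apply: moderateD; [exact: moderate_dotv|exact: moderate_cst]. Qed.

Let moderate_q x : moderate (fun y => `|p x y| + p x y).
Proof. by apply: moderateD => //; exact: moderate_norm. Qed.

Let q_ge0 x : 0 <= q x.
Proof.
apply: (wint_ge0 s0 cw w0 wW) => // y.
by have := ler_norm (- p x y); rewrite normrN; lra.
Qed.

Let q_gt0 x : x != 0 -> 0 < q x.
Proof.
(* At [y = x + z] the value of [p x y] is [sqnorm x]. *)
move=> x0; apply: (@wint_gt0 _ _ _ _ _ s0 cw w0 wW _ (x + z)) => // [y|].
  by have := ler_norm (- p x y); rewrite normrN; lra.
rewrite ltr_wpDl// /p (dotvC _ (_ + _)) dotvDl (dotvC z) addrK -sqnormE.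
exact: sqnorm_gt0.
Qed.

Let q_homogeneous a x : 0 <= a -> q (a *: x) = a * q x.
Proof.
move=> a0; rewrite /q -(wintZ s0 cw w0 wW)//; congr wint; apply/funext => y.
by rewrite /p !dotvZl -mulrBr normrM (ger0_norm a0) [RHS]mulrDr.
Qed.

Let q_continuous : continuous q.
Proof.
apply: locally_lipschitz_continuous => x.
(* The factor 2 counts the variation of [p] and that of its absolute value. *)
pose G y := 2 * (norm1 y + norm1 z).
have mG : moderate G.
  apply: moderateM; first exact: moderate_cst.
  by apply: moderateD; [exact: moderate_norm1|exact: moderate_cst].
exists (wint s w G) => x' _.
rewrite /q -(wintB s0 cw w0 wW)// mulrC -(wintZ s0 cw w0 wW)//.
apply: (norm_wint s0 cw w0 wW).
- by apply: moderateD => //; exact: moderateN.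
- by apply: moderateM => //; exact: moderate_cst.
move=> y.
have pB : `|p x' y - p x y| <= `|x' - x| * (norm1 y + norm1 z).
  have -> : p x' y - p x y = dotv (x' - x) y - dotv (x' - x) z.
    by rewrite /p !dotvBl; ring.
  apply: le_trans (ler_normB _ _) _; rewrite mulrDr.
  by apply: lerD; exact: norm_dotv.
rewrite [X in `|X|](_ : _ = (`|p x' y| - `|p x y|) + (p x' y - p x y)); last by ring.
apply: le_trans (ler_normD _ _) _.
have := ler_dist_dist (p x' y) (p x y).
by rewrite /G; lra.
Qed.

(** The constant is the minimum of [q] on the compact unit sphere; homogeneity extends the bound to
    all vectors. *)
Let q_coercive : exists2 m, 0 < m & forall x, m * `|x| <= q x.
Proof.
(* In dimension 0 the sphere is empty and has no minimizer, but any constant works. *)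
have [[x0 x00]|nx0] := pselect (exists x : 'rV[R]_n, x != 0); last first.
  exists 1 => // x; have [->|x0] := eqVneq x 0; first by rewrite normr0 mulr0.
  by exfalso; apply: nx0; exists x.
pose S := [set x : 'rV[R]_n | `|x| = 1].
have unitS x : x != 0 -> S (`|x|^-1 *: x).
  by move=> xn0; rewrite /S/= normrZ normfV normr_id mulVf// normr_eq0.
have cS : compact S.
  apply: bounded_closed_compact.
    by exists 1; split=> // M M1 x /= ->; exact: ltW.
  rewrite (_ : S = (fun x : 'rV[R]_n => `|x|) @^-1` [set 1])//.
  apply: preimage_closed; last exact: closed_eq.
  by move=> ? _; exact: norm_continuous.
have [||c cS' cmin] := @EVT_min_rV _ _ q S _ cS.
- by exists (`|x0|^-1 *: x0); exact: unitS.
- by apply: continuous_subspaceT; exact: q_continuous.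
exists (q c).
  apply: q_gt0; move: cS'; rewrite inE /S/= => c1.
  by rewrite -normr_eq0 c1 oner_eq0.
move=> x; have [->|xn0] := eqVneq x 0; first by rewrite normr0 mulr0.
have nx : 0 < `|x| by rewrite normr_gt0.
have := cmin (`|x|^-1 *: x); rewrite inE => /(_ (unitS _ xn0)).
by rewrite q_homogeneous ?invr_ge0// => h; rewrite -ler_pdivlMr// mulrC.
Qed.

Let Lam_gt0 x : 0 < Lam x.
Proof. by rewrite mulr_gt0// expR_gt0. Qed.

(** [Lam x] integrates [expR (p x y / s)]. Pointwise, [|p| + p] is 0 for [p < 0], and for [p >= 0]
    it equals [2 * p], below [2 * s * (1 + p / s)]. *)
Let q_le_Lam x : q x <= 2 * s * Lam x.
Proof.
rewrite /Lam /laplace mulrA -(wintZ s0 cw w0 wW); last first.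
  by apply: moderate_exp; exact: moderate_cst.
apply: (le_wint s0 cw w0 wW) => // [|y].
  apply: moderateM; first exact: moderate_cst.
  by apply: moderate_exp; exact: moderate_cst.
rewrite mulr1 -mulrA -expRD.
have -> : - (dotv z x / s) + dotv x y / s = p x y / s.
  by rewrite /p (dotvC z); ring.
have s2 : 0 < 2 * s by rewrite mulr_gt0.
have [p0|p0] := leP 0 (p x y); last first.
  by rewrite ltr0_norm// addNr mulr_ge0 ?expR_ge0// ltW.
rewrite ger0_norm//; apply: (@le_trans _ _ (2 * s * (1 + p x y / s))).
  rewrite (_ : _ * (1 + _) = 2 * s + (p x y + p x y)); first by rewrite lerDr ltW.
  by field; rewrite gt_eqF.
by rewrite (ler_wpM2l (ltW s2))// le1Dx_expR.
Qed.

Let Lam_continuous : continuous Lam.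
Proof.
move=> x; apply: (@continuousM _ _ (fun x => expR (- (dotv z x / s))) L1).
  apply: (@continuous_comp _ _ _ (fun x => - (dotv z x / s)) expR).
    apply: continuousN; apply: continuousM; last exact: cst_continuous.
    exact: continuous_dotv.
  exact: continuous_expR.
by apply: (laplace_continuous s0 cw w0 wW); exact: moderate_cst.
Qed.

Let Lam_argmin : exists c, forall x, Lam c <= Lam x.
Proof.
have [m m0 mq] := q_coercive.
(* Where [|x| > r], one has [2 * s * Lam 0 < m * |x| <= q x <= 2 * s * Lam x], so the minimum over
   the ball of radius [r] is global. *)
pose r := 2 * s * Lam 0 / m.
have r0 : 0 <= r by rewrite divr_ge0 ?ltW// mulr_gt0// mulr_gt0.
pose B := [set x : 'rV[R]_n | `|x| <= r].
have cB : compact B.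
  apply: bounded_closed_compact.
    by exists r; split=> [|M rM x /= xr]; [exact: num_real|apply: le_trans xr (ltW rM)].
  rewrite (_ : B = (fun x : 'rV[R]_n => `|x|) @^-1` [set t | t <= r])//.
  apply: preimage_closed; last exact: closed_le.
  by move=> ? _; exact: norm_continuous.
have B0 : B 0 by rewrite /B/= normr0.
have [||c cB' cmin] := @EVT_min_rV _ _ Lam B _ cB.
- by exists 0.
- by apply: continuous_subspaceT; exact: Lam_continuous.
exists c => x; have [xr|rx] := leP `|x| r; first by apply: cmin; rewrite inE.
apply: (@le_trans _ _ (Lam 0)); first by apply: cmin; rewrite inE.
move: rx; rewrite /r ltr_pdivrMr// (mulrC _ m) => /ltW/le_trans/(_ (mq x)).
by move=> /le_trans/(_ (q_le_Lam x)); rewrite ler_pM2l// mulr_gt0.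
Qed.

Lemma tilted_mean_surj : exists x, tilted_mean x = z.
Proof.
have [c cmin] := Lam_argmin; exists c; apply/rowP => i.
have m1 : moderate (fun _ : 'rV[R]_n => 1 : R) := moderate_cst 1.
have [M HM] := laplace_quadratic s0 cw w0 wW c i m1.
have LE : L (fun y => y ord0 i / s * 1) c = L1 c * tilted_mean c ord0 i / s.
  rewrite -tilted_meanE mulrC -(wintZ s0 cw w0 wW); last first.
    by apply: moderate_exp; exact: moderate_coord.
  by congr wint; apply/funext => y; ring.
have D0 : L1 c * z ord0 i / s - L1 c * tilted_mean c ord0 i / s = 0.
  (* Minimality at [c] bounds [L1] at the shifted point below by [L1 c * (1 + t * z ord0 i / s)];
     the quadratic expansion bounds it above, with the tilted mean in place of [z]. The two bounds
     differ by a linear term, which must vanish. *)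
  apply: (@linear_le_quadratic _ _ M) => t t1.
  have := HM t t1; rewrite LE => /(le_trans (ler_norm _)).
  have := cmin (t *: delta_mx ord0 i + c); rewrite /Lam !(dotvC z) dotvDl dotvZl dotv_delta.
  set A := L1 (_ + _) => h.
  have {h} : L1 c * expR (t * z ord0 i / s) <= A.
    rewrite -(ler_pM2l (expR_gt0 (- ((t * z ord0 i + dotv c z) / s)))).
    rewrite (_ : _ * (L1 c * _) = expR (- (dotv c z / s)) * L1 c)//.
    by rewrite mulrCA -expRD mulrC; congr (expR _ * _); ring.
  have : L1 c * (1 + t * z ord0 i / s) <= L1 c * expR (t * z ord0 i / s).
    by rewrite ler_wpM2l ?le1Dx_expR// ltW.
  have -> : L1 c * (1 + t * z ord0 i / s) = L1 c + t * (L1 c * z ord0 i / s) by ring.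
  by move=> h1 h2 h3; rewrite mulrBr; lra.
move: D0 => /eqP; rewrite subr_eq0 => /eqP D0.
have L1n0 : L1 c != 0 by rewrite gt_eqF.
have sn0 : s^-1 != 0 by rewrite invr_neq0// gt_eqF.
by apply: (mulfI L1n0); apply: (mulIf sn0).
Qed.

End surjectivity.

Lemma tilted_mean_bij : bijective tilted_mean.
Proof.
have [g gK] := choice tilted_mean_surj.
by exists g => // x; apply: tilted_mean_inj; rewrite gK.
Qed.

(** Expanding the square moves the normalisation and the factor in [sqnorm x] out of the integral;
    both then cancel in the quotient defining [zprox]. *)
Lemma gauss_expE h x : moderate h ->
  gauss_exp s x (fun y => h y * w y) =
  powR (2 * pi * s) (- n%:R / 2) * expR (- sqnorm x / (2 * s)) * L h x.
Proof.
move=> mh; rewrite /laplace -(wintZ s0 cw w0 wW); last exact: moderate_exp.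
rewrite /gauss_exp /wint; congr RintRn; apply/funext => y; rewrite /gauss_dens.
have -> : expR (- sqnorm (y - x) / (2 * s)) =
    expR (- sqnorm x / (2 * s)) * expR (- sqnorm y / (2 * s)) * expR (dotv x y / s).
  by rewrite -!expRD sqnormB (dotvC y); congr expR; field; rewrite gt_eqF.
by ring.
Qed.

End tilted_mean.

(** * The zeroth-order proximal operator *)

Section zeroth_order_prox.
Context {R : realType} {n : nat}.
Variables (lam del : R) (f : 'rV[R]_n -> R) (xm : 'rV[R]_n).
Hypotheses (lam0 : 0 < lam) (del0 : 0 < del) (cf : continuous f).
Hypothesis fmin : forall y, f xm <= f y.
Implicit Types x y : 'rV[R]_n.

Let s := lam * del.
Let w y := expR (- f y / del).

Let s0 : 0 < s. Proof. exact: mulr_gt0. Qed.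

Let w_continuous : continuous w.
Proof.
move=> y; apply: (@continuous_comp _ _ _ (fun y => - f y / del) expR).
  by apply: continuousM; [apply: continuousN; exact: cf|exact: cst_continuous].
exact: continuous_expR.
Qed.

Let w_gt0 y : 0 < w y. Proof. exact: expR_gt0. Qed.

Let w_le y : w y <= expR (- f xm / del).
Proof. by rewrite ler_expR ler_wpM2r ?lerN2// invr_ge0 ltW. Qed.

Let c x := powR (2 * pi * s) (- n%:R / 2) * expR (- sqnorm x / (2 * s)).

Let c_gt0 x : 0 < c x.
Proof. by rewrite mulr_gt0 ?expR_gt0// powR_gt0// !mulr_gt0// pi_gt0. Qed.

Let gauss_exp_w x : gauss_exp s x w = c x * laplace s w (fun=> 1) x.
Proof.
rewrite -(gauss_expE s0 w_continuous w_gt0 w_le); last exact: moderate_cst.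
by congr gauss_exp; apply/funext => y; rewrite mul1r.
Qed.

Lemma zproxE : zprox lam del f = tilted_mean s w.
Proof.
apply/funext => x; rewrite /zprox -/s -/w gauss_exp_w; apply/rowP => i.
rewrite !mxE (gauss_expE s0 w_continuous w_gt0 w_le); last exact: moderate_coord.
by rewrite -/(c x) invfM mulrACA mulVf ?mul1r// gt_eqF.
Qed.

Let objective zinv x y := lam * del * Hfun lam del f zinv y + sqnorm (y - x) / 2.

(** The squares of [x'] and of [zprox x'] cancel between the envelope, [Hfun] and the quadratic
    penalty. What remains in the last bracket is the tangent of [ln L1] at [x'], evaluated at
    [x]. *)
Let objectiveE zinv x x' : cancel (zprox lam del f) zinv ->
  objective zinv x (zprox lam del f x') =
  sqnorm x / 2 - s * ln (powR (2 * pi * s) (- n%:R / 2))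
  - s * (ln (laplace s w (fun=> 1) x') + dotv (x - x') (tilted_mean s w x') / s).
Proof.
move=> zK; rewrite /objective /Hfun zK /soft_moreau -/s -/w gauss_exp_w zproxE.
have L0 := laplace1_gt0 s0 w_continuous w_gt0 w_le x'.
rewrite lnM ?posrE// /c lnM ?posrE ?expR_gt0//; last first.
  by rewrite powR_gt0// !mulr_gt0// pi_gt0.
rewrite expRK !sqnormB dotvBl (dotvC _ x) /s.
by field; rewrite !gt_eqF.
Qed.

Let objective_lt zinv x x' : cancel (zprox lam del f) zinv -> x != x' ->
  objective zinv x (zprox lam del f x) < objective zinv x (zprox lam del f x').
Proof.
move=> zK xx'; rewrite !objectiveE// ltrD2l ltrN2 ltr_pM2l//.
rewrite subrr dotv0l mul0r addr0.
exact: (tilted_mean_convex s0 w_continuous w_gt0 w_le xx').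
Qed.

(** By bijectivity every competitor is [zprox (zinv y)], so [objective_lt] compares all of them with
    [zprox x]. *)
Lemma prox_set_zprox zinv x :
  cancel (zprox lam del f) zinv -> cancel zinv (zprox lam del f) ->
  prox_set (fun y => lam * del * Hfun lam del f zinv y) x = [set zprox lam del f x].
Proof.
move=> zK Kz; apply/seteqP; split=> [p pmin|_ -> y] /=.
  rewrite -(Kz p); have [<-//|xp] := eqVneq x (zinv p).
  have := objective_lt zK xp; rewrite Kz ltNge => /negP[].
  exact: pmin.
rewrite -(Kz y); have [<-//|xy] := eqVneq x (zinv y).
exact: ltW (objective_lt zK xy).
Qed.

Lemma zprox_smooth : smooth (zprox lam del f).
Proof. by rewrite zproxE; exact: (smooth_tilted_mean s0 w_continuous w_gt0 w_le). Qed.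

Lemma zprox_bij : bijective (zprox lam del f).
Proof. by rewrite zproxE; exact: (tilted_mean_bij s0 w_continuous w_gt0 w_le). Qed.

End zeroth_order_prox.

Theorem theorem1 (R : realType) (d : nat) (lam del : R) (f : 'rV[R]_d -> R) :
  (0 < d)%N -> 0 < lam -> 0 < del ->
  continuous f -> (exists xm : 'rV[R]_d, forall y, f xm <= f y) ->
  (intRn (fun y : 'rV[R]_d => (expR (- f y / del))%:E) < +oo)%E ->
  [/\ smooth (zprox lam del f),
      bijective (zprox lam del f),
      (forall zinv : 'rV[R]_d -> 'rV[R]_d,
         cancel (zprox lam del f) zinv -> cancel zinv (zprox lam del f) ->
         forall x, prox_set (fun y => lam * del * Hfun lam del f zinv y) x
                   = [set zprox lam del f x])
    & (forall zinv : 'rV[R]_d -> 'rV[R]_d,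
         cancel (zprox lam del f) zinv -> cancel zinv (zprox lam del f) ->
         forall xs : nat -> 'rV[R]_d,
           (forall k, xs k.+1 = zprox lam del f (xs k)) ->
           forall k, prox_set (fun y => lam * del * Hfun lam del f zinv y) (xs k)
                     = [set xs k.+1])].
Proof.
move=> _ lam0 del0 cf [xm fmin] _.
have P := prox_set_zprox lam0 del0 cf fmin.
split; [exact: (zprox_smooth lam0 del0 cf fmin)|exact: (zprox_bij lam0 del0 cf fmin)| |].
- by move=> zinv zK Kz x; exact: P.
- by move=> zinv zK Kz xs xsE k; rewrite xsE; exact: P.
Qed.
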